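(* Let $i,j\geq 3$ be integers with $i\neq 5$ and $j\neq 5$. Then $s_5(P_i\square C_j)=4$.
   Context: $P_k$ denotes the path on $k$ vertices, $C_k$ the cycle on $k$ vertices, and $\square$ denotes the Cartesian product of graphs. A $P_k$-coloring of a graph $G$ is a proper vertex coloring of $G$ in which no copy of $P_k$ in $G$ (as a subgraph, not necessarily induced) is bicolored, i.e. has its vertices colored using only two colors. The $P_k$-chromatic number $s_k(G)$ is the minimum number of colors in a $P_k$-coloring of $G$. *)

(* Defs.v *)
From mathcomp Require Import all_boot.

Set Implicit Arguments.
Unset Strict Implicit.
Unset Printing Implicit Defensive.

Record graph := Graph {
  vertex :> finType;
  adj : rel vertex;
  adj_sym : symmetric adj;
  adj_irr : irreflexive adj
}.

Section PathGraph.
Variable n : nat.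

Definition path_adj : rel 'I_n :=
  [rel x y : 'I_n | (x.+1 == y :> nat) || (y.+1 == x :> nat)].

Lemma path_adj_sym : symmetric path_adj.
Proof. by move=> x y; rewrite /path_adj /= orbC. Qed.

Lemma path_adj_irr : irreflexive path_adj.
Proof. by move=> x; rewrite /path_adj /= orbb gtn_eqF. Qed.

Definition path_graph := Graph path_adj_sym path_adj_irr.

(* The conjunct x != y only matters for n = 1, where it removes the loop. *)
Definition cycle_adj : rel 'I_n :=
  [rel x y : 'I_n |
     (x != y) && ((x.+1 %% n == y :> nat) || (y.+1 %% n == x :> nat))].

Lemma cycle_adj_sym : symmetric cycle_adj.
Proof. by move=> x y; rewrite /cycle_adj /= eq_sym orbC. Qed.

Lemma cycle_adj_irr : irreflexive cycle_adj.
Proof. by move=> x; rewrite /cycle_adj /= eqxx. Qed.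

Definition cycle_graph := Graph cycle_adj_sym cycle_adj_irr.

End PathGraph.

Section CartesianProduct.
Variables G H : graph.

Definition cart_adj : rel (G * H)%type :=
  [rel u v : G * H | (u.1 == v.1) && adj u.2 v.2
                  || (u.2 == v.2) && adj u.1 v.1].

Lemma cart_adj_sym : symmetric cart_adj.
Proof.
by move=> u v; rewrite /cart_adj /= eq_sym adj_sym [u.2 == _]eq_sym [adj u.1 _]adj_sym.
Qed.

Lemma cart_adj_irr : irreflexive cart_adj.
Proof. by move=> u; rewrite /cart_adj /= !adj_irr !andbF. Qed.

Definition cart := Graph cart_adj_sym cart_adj_irr.

End CartesianProduct.

Notation "G □ H" := (cart G H) (at level 40, left associativity).

Section PathColoring.
Variable G : graph.

Definition proper_coloring (C : finType) (c : {ffun G -> C}) : bool :=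
  [forall x, forall y, adj x y ==> (c x != c y)].

(* A not necessarily induced copy of P_k in G is given by an injective
   homomorphism from P_k to G. *)
Definition is_path_copy (k : nat) (p : {ffun path_graph k -> G}) : bool :=
  injectiveb p && [forall a, forall b, adj a b ==> adj (p a) (p b)].

Definition bicolored (C : finType) (c : {ffun G -> C}) (k : nat)
    (p : {ffun path_graph k -> G}) : bool :=
  #|[set c (p a) | a : path_graph k]| <= 2.

Definition Pk_coloring (k : nat) (C : finType) (c : {ffun G -> C}) : bool :=
  proper_coloring c &&
  [forall p : {ffun path_graph k -> G}, is_path_copy p ==> ~~ bicolored c p].

Definition Pk_colorable (k m : nat) : bool :=
  [exists c : {ffun G -> 'I_m}, Pk_coloring k c].

(* The minimum is taken over m <= #|G|, which loses nothing when k >= 3, since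
   then giving each vertex its own color is a P_k-coloring: see
   Pk_chromatic_numberP. If no P_k-coloring exists, which can only
   happen for k <= 2, the value is #|G|. *)
Definition Pk_chromatic_number (k : nat) : nat :=
  [arg min_(m < (ord_max : 'I_#|G|.+1) | Pk_colorable k m) (m : nat)].

Lemma Pk_colorable_card k : 2 < k -> Pk_colorable k #|G|.
Proof.
move=> k_gt2; apply/existsP; exists [ffun x => enum_rank x].
apply/andP; split.
  apply/forallP=> x; apply/forallP=> y; apply/implyP; rewrite !ffunE.
  by apply: contraTneq => /enum_rank_inj->; rewrite adj_irr.
apply/forallP=> p; apply/implyP=> /andP[/injectiveP p_inj _].
rewrite /bicolored card_imset ?card_ord -?ltnNge // => a b.
by rewrite !ffunE => /enum_rank_inj /p_inj.
Qed.

Lemma Pk_chromatic_numberP k : 2 < k ->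
  Pk_colorable k (Pk_chromatic_number k) /\
  (forall m, Pk_colorable k m -> Pk_chromatic_number k <= m).
Proof.
move=> k_gt2; rewrite /Pk_chromatic_number.
case: arg_minnP => [|m colm min_m]; first exact: Pk_colorable_card.
split=> // n coln; have [n_lt|n_ge] := ltnP n #|G|.+1.
  exact: (min_m (Ordinal n_lt)).
by apply: leq_trans (ltnW n_ge); rewrite -ltnS.
Qed.

End PathColoring.

(* Main.v *)
(* Upper bound: colour each factor by vectors of F_2^2 so that any two vertices
   at distance 1 or 2 get distinct colours, and colour the product by the sum
   of the two coordinates' colours. All edges of a bicolored path have the same
   colour difference d, and in each factor the edges of difference d form a
   matching, so in the product they form components with at most 4 vertices.
   Cycles other than C_5 have such a colouring because j is a sum of 3s and 4s.
   Lower bound: P_3 □ P_3 already has no P_5-coloring with 3 colours. *)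
Require Import Defs.
From mathcomp Require Import all_boot zify.

Set Implicit Arguments.
Unset Strict Implicit.
Unset Printing Implicit Defensive.

(** * Changing colours, restricting to subgraphs, and a criterion for P_5-colorings *)

Section PathColoringTheory.
Variable G : graph.

Lemma Pk_coloring_comp_inj (C D : finType) (h : C -> D) (c : {ffun G -> C}) k :
  injective h -> Pk_coloring k c -> Pk_coloring k [ffun x => h (c x)].
Proof.
move=> h_inj /andP[/forallP c_proper /forallP c_path]; apply/andP; split.
  apply/forallP=> x; apply/forallP=> y; rewrite !ffunE (inj_eq h_inj).
  exact: (forallP (c_proper x)).
apply/forallP=> p; apply/implyP=> p_path.
have:= implyP (c_path p) p_path; apply: contraNN; rewrite /bicolored.
rewrite -(card_imset _ h_inj) -imset_comp.
by congr (#|pred_of_set _| <= 2); apply: eq_imset => a /=; rewrite ffunE.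
Qed.

Lemma Pk_coloring_colorable (C : finType) (c : {ffun G -> C}) k :
  Pk_coloring k c -> Pk_colorable G k #|C|.
Proof.
move=> c_col; apply/existsP; exists [ffun x => enum_rank (c x)].
by apply: Pk_coloring_comp_inj c_col; apply: enum_rank_inj.
Qed.

Lemma Pk_colorable_leq k m n : m <= n -> Pk_colorable G k m -> Pk_colorable G k n.
Proof.
move=> le_mn /existsP[c c_col]; apply/existsP; exists [ffun x => widen_ord le_mn (c x)].
by apply: Pk_coloring_comp_inj c_col => a b /(congr1 val) /= /val_inj.
Qed.

(** In a proper colouring consecutive colours of a path differ, so a path with only two colours
    alternates between them; the three equalities express exactly this alternation. *)
Lemma P5_coloringP (C : finType) (c : {ffun G -> C}) :
  reflect ((forall x y, adj x y -> c x != c y) /\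
           (forall x0 x1 x2 x3 x4, path (@adj G) x0 [:: x1; x2; x3; x4] ->
              uniq [:: x0; x1; x2; x3; x4] ->
              ~~ [&& c x0 == c x2, c x2 == c x4 & c x1 == c x3]))
          (Pk_coloring 5 c).
Proof.
apply: (iffP andP) => -[c_proper c_path].
  split=> [x y|x0 x1 x2 x3 x4 x_path x_uniq].
    by move: c_proper => /forallP/(_ x)/forallP/(_ y)/implyP.
  pose p : {ffun path_graph 5 -> G} := [ffun a => nth x0 [:: x0; x1; x2; x3; x4] (a : 'I_5)].
  have p_path : is_path_copy p.
    apply/andP; split.
      apply/injectiveP=> a b; rewrite !ffunE => /eqP.
      by rewrite nth_uniq //= ?ltn_ord // => /eqP/val_inj.
    have p_step (a b : 'I_5) : a.+1 = b -> adj (p a) (p b).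
      rewrite !ffunE => ab; rewrite -ab; have lt_a : a < 4 by rewrite -ltnS ab.
      exact: (pathP x0 x_path).
    apply/forallP=> a; apply/forallP=> b; apply/implyP=> /orP[]/eqP/p_step //.
    by rewrite adj_sym.
  move: c_path => /forallP/(_ p)/implyP/(_ p_path); apply: contraNN.
  case/and3P=> /eqP c02 /eqP c24 /eqP c13; rewrite /bicolored.
  apply: leq_trans (subset_leq_card (_ : _ \subset [set c x0; c x1])) _; last first.
    by rewrite cards2; case: (_ != _).
  apply/subsetP=> _ /imsetP[a _ ->]; rewrite ffunE !inE.
  by case: a => [[|[|[|[|[|//]]]]] a_lt] /=; rewrite -?c24 -?c02 -?c13 eqxx ?orbT.
split; first by do 2!apply/forallP=> ?; apply/implyP/c_proper.
apply/forallP=> p; apply/implyP=> /andP[/injectiveP p_inj p_adj].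
pose o m : path_graph 5 := inord m : 'I_5.
have oE m : m < 5 -> o m = m :> nat by apply: inordK.
have step m : m < 4 -> adj (p (o m)) (p (o m.+1)).
  move=> m_lt; have /forallP/(_ (o m))/forallP/(_ (o m.+1))/implyP := p_adj.
  by apply; rewrite /= /path_adj /= !oE ?eqxx // ltnW.
have p_uniq : uniq [seq p (o m) | m <- iota 0 5].
  rewrite map_inj_in_uniq ?iota_uniq // => m n; rewrite !mem_iota /= => m_lt n_lt.
  by move=> /p_inj/(congr1 val) /=; rewrite !oE.
apply: contraTN (c_path _ _ _ _ _ _ p_uniq) => [p_bi|] /=; last by rewrite !step.
have c_step m : m < 4 -> c (p (o m)) != c (p (o m.+1)) by move/step/c_proper.
(* The first two colours are distinct, so they exhaust an image of at most two colours. *)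
have c_in m : c (p (o m)) \in [set c (p (o 0)); c (p (o 1))].
  have/eqP -> : [set c (p (o 0)); c (p (o 1))] == [set c (p a) | a : path_graph 5].
    rewrite eqEcard (leq_trans p_bi) ?cards2 ?c_step // andbT.
    by apply/subsetP=> d /set2P[]->; apply: imset_f.
  exact: imset_f.
move: (c_step 0 isT) (c_step 1 isT) (c_step 2 isT) (c_step 3 isT).
move: (c_in 2) (c_in 3) (c_in 4); rewrite !inE negbK.
do 3!case/orP=> /eqP->; by rewrite ?eqxx.
Qed.

End PathColoringTheory.

Lemma Pk_colorable_sub (G H : graph) (h : G -> H) k m :
    injective h -> (forall x y, adj x y -> adj (h x) (h y)) ->
  Pk_colorable H k m -> Pk_colorable G k m.
Proof.
move=> h_inj h_adj /existsP[c /andP[/forallP c_proper /forallP c_path]].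
apply/existsP; exists [ffun x => c (h x)]; apply/andP; split.
  apply/forallP=> x; apply/forallP=> y; apply/implyP=> xy; rewrite !ffunE.
  by have/forallP/(_ (h y))/implyP := c_proper (h x); apply; apply: h_adj.
apply/forallP=> p; apply/implyP=> /andP[/injectiveP p_inj /forallP p_adj].
have := c_path [ffun a => h (p a)]; rewrite [is_path_copy _](_ : _ = true); last first.
  apply/andP; split.
    by apply/injectiveP=> a b; rewrite !ffunE => /h_inj/p_inj.
  apply/forallP=> a; apply/forallP=> b; apply/implyP=> ab; rewrite !ffunE.
  by apply/h_adj/(implyP (forallP (p_adj a) b)).
apply: contraNN; rewrite /bicolored.
by congr (#|pred_of_set _| <= 2); apply: eq_imset => a; rewrite !ffunE.
Qed.

(** * Sums of distance-two colorings on Cartesian products *)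

Definition dist2_coloring (G : graph) (C : eqType) (f : G -> C) :=
  (forall x y, adj x y -> f x != f y) /\
  (forall x y z, adj x y -> adj x z -> f y = f z -> y = z).

(** Addition in F_2^2. *)
Definition xor2 (a b : bool * bool) := (a.1 (+) b.1, a.2 (+) b.2).

Lemma xor2I : right_injective xor2.
Proof. by case=> [[] []] [[] []] [[] []]. Qed.

Lemma xor2IN : left_injective xor2.
Proof. by case=> [[] []] [[] []] [[] []]. Qed.

(** In characteristic 2 both [a + a'] and [a' + a''] equal [b + b']. This compares opposite sides of
    the square traced by an alternating path. *)
Lemma xor2_square a a' a'' b b' :
  xor2 a b = xor2 a' b' -> xor2 a' b = xor2 a'' b' -> a = a''.
Proof.
by case: a a' a'' b b' => [[] []] [[] []] [[] []] [[] []] [[] []].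
Qed.

Lemma xor2C : commutative xor2.
Proof. by case=> [[] []] [[] []]. Qed.

Lemma dist2_cart_P5 (G H : graph) (f : G -> bool * bool) (g : H -> bool * bool) :
    dist2_coloring f -> dist2_coloring g ->
  Pk_coloring 5 [ffun u : G □ H => xor2 (f u.1) (g u.2)].
Proof.
move=> [f_proper f_inj] [g_proper g_inj]; apply/P5_coloringP; split.
  case=> [x y] [x' y'] /orP[]/andP[/= /eqP-> uv]; rewrite !ffunE /=.
    by rewrite (inj_eq (@xor2I _)) g_proper.
  by rewrite (inj_eq (@xor2IN _)) f_proper.
(* Two consecutive edges cannot lie in the same factor, so the path alternates
   between the factors and closes up into a 4-cycle. *)
have turn u v w : cart_adj u v -> cart_adj v w -> u != w ->
    xor2 (f u.1) (g u.2) = xor2 (f w.1) (g w.2) ->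
  [/\ u.1 = v.1, v.2 = w.2, adj u.2 v.2 & adj v.1 w.1] \/
  [/\ u.2 = v.2, v.1 = w.1, adj u.1 v.1 & adj v.2 w.2].
  case: u v w => [x y] [x' y'] [x'' y''].
  case/orP=> /andP[/= /eqP<- uv] /orP[]/andP[/= /eqP<- vw] neq_uw.
  - rewrite adj_sym in uv; move/xor2I/(g_inj _ _ _ uv vw) => y_eq.
    by rewrite y_eq eqxx in neq_uw.
  - by left.
  - by right.
  - rewrite adj_sym in uv; move/xor2IN/(f_inj _ _ _ uv vw) => x_eq.
    by rewrite x_eq eqxx in neq_uw.
move=> [x0 y0] [x1 y1] [x2 y2] [x3 y3] [x4 y4] /and5P[e01 e12 e23 e34 _] u_uniq.
apply/and3P; rewrite !ffunE => -[/eqP c02 /eqP c24 /eqP c13].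
case/and5P: u_uniq; rewrite !inE !negb_or.
move=> /and4P[_ n02 _ n04] /and3P[_ n13 _] /andP[_ n24] _ _.
have c04 := etrans c02 c24.
case/eqP: n04.
have := turn _ _ _ e23 e34 n24 c24; have := turn _ _ _ e12 e23 n13 c13.
have := turn _ _ _ e01 e12 n02 c02; rewrite /= in c02 c04 c13 *.
(* Of the eight combinations, those that do not alternate force a loop. In the two others, the first
   and third edges project to edges sharing an endpoint; their other ends have equal colours, hence
   coincide. The second and fourth edges are then treated alike, so the fifth vertex is the
   first. *)
case=> [[??]|[??]] a01 a12; case=> [[??]|[??]] a12' a23; case=> [[??]|[??]] a23' a34;
  subst; rewrite ?adj_irr // in a12 a23; rewrite adj_sym in a01; rewrite adj_sym in a12.
  rewrite ![xor2 (f _) _]xor2C in c02 c13.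
  have y_eq := g_inj _ _ _ a01 a23 (xor2_square c02 c13).
  by rewrite y_eq in c04 *; rewrite (f_inj _ _ _ a12 a34 (xor2IN c04)).
have x_eq := f_inj _ _ _ a01 a23 (xor2_square c02 c13).
by rewrite x_eq in c04 *; rewrite (g_inj _ _ _ a12 a34 (xor2I c04)).
Qed.

(** * Distance-two colorings of paths and cycles *)

Definition bits n := (odd n, odd n./2).

Lemma bits_inj m n : m < 4 -> n < 4 -> bits m = bits n -> m = n.
Proof. by case: m n => [|[|[|[|m]]]] [|[|[|[|n]]]]. Qed.

Lemma dist2_path n : dist2_coloring (fun x : path_graph n => bits ((x : 'I_n) %% 4)).
Proof.
have bits_mod x y : bits (x %% 4) = bits (y %% 4) -> x %% 4 = y %% 4.
  by apply: bits_inj; rewrite ltn_mod.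
split=> [x y|x y z].
  by case/orP=> /eqP xy; apply/eqP=> /bits_mod; lia.
by case/orP=> /eqP xy /orP[]/eqP xz /bits_mod yz; apply: val_inj => /=; lia.
Qed.

(* [j = 4 * (j %% 3) + 3 * q] with [q >= 0] for all [j >= 3] but 5; around the
   cycle go [j %% 3] blocks 0123 followed by [q] blocks 012. *)
Definition cycle_word j k :=
  if k < 4 * (j %% 3) then k %% 4 else (k - 4 * (j %% 3)) %% 3.

Lemma cycle_word_lt4 j k : cycle_word j k < 4.
Proof. by rewrite /cycle_word; case: ifP; lia. Qed.

(** Every block climbs from 0 to 2 or 3 before the next one restarts at 0, also across the closing
    edge. This alone makes letters one or two steps apart distinct. *)
Lemma cycle_word_succ j k : 3 <= j -> j <> 5 -> k < j ->
  cycle_word j (k.+1 %% j) = (cycle_word j k).+1 \/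
  cycle_word j (k.+1 %% j) = 0 /\ 2 <= cycle_word j k.
Proof.
move=> j_ge3 j_neq5 k_lt; have [k_eq|k_neq] := eqVneq k.+1 j.
  by rewrite k_eq modnn /cycle_word; do !case: ifP; lia.
rewrite modn_small; last by lia.
by rewrite /cycle_word; do !case: ifP; lia.
Qed.

Lemma dist2_cycle j : 3 <= j -> j <> 5 ->
  dist2_coloring (fun x : cycle_graph j => bits (cycle_word j (x : 'I_j))).
Proof.
move=> j_ge3 j_neq5; have word_inj x y := bits_inj (cycle_word_lt4 j x) (cycle_word_lt4 j y).
have succ k := cycle_word_succ j_ge3 j_neq5 (k := k).
have succ_lt k : k.+1 %% j < j by rewrite ltn_mod; lia.
have succ_neq k : k < j -> cycle_word j k <> cycle_word j (k.+1 %% j).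
  by move/succ; lia.
have succ2_neq k : k < j -> cycle_word j k <> cycle_word j ((k.+1 %% j).+1 %% j).
  by move=> k_lt; have := succ _ k_lt; have := succ _ (succ_lt k); lia.
have succ_inj m n : m < j -> n < j -> m.+1 %% j = n.+1 %% j -> m = n.
  move=> m_lt n_lt /eqP; rewrite -[m.+1]addn1 -[n.+1]addn1 eqn_modDr.
  by rewrite !modn_small // => /eqP.
split=> [x y|x y z] /=; rewrite /cycle_adj /=.
  case/andP=> _ /orP[]/eqP<-; apply/eqP=> /word_inj; last move/esym; exact: succ_neq.
(* If one neighbour of [x] is its successor and the other its predecessor, they are two steps apart
   and [succ2_neq] applies; otherwise they coincide. *)
case/andP=> _ /orP[]/eqP xy /andP[_] /orP[]/eqP xz /word_inj yz; apply: val_inj => /=.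
- by rewrite -xy -xz.
- by case: (succ2_neq z); rewrite ?xz ?xy.
- by case: (succ2_neq y); rewrite ?xy ?xz.
- by apply: succ_inj; rewrite ?xy ?xz.
Qed.

(** * The lower bound and the conclusion *)

Lemma P3_cart_P3_not_3colorable :
  ~~ Pk_colorable (path_graph 3 □ path_graph 3) 5 3.
Proof.
apply/existsP=> -[c /P5_coloringP[c_proper c_path]].
pose v a b a_lt b_lt : path_graph 3 □ path_graph 3 :=
  (@Ordinal 3 a a_lt, @Ordinal 3 b b_lt).
pose x00 := v 0 0 isT isT; pose x01 := v 0 1 isT isT; pose x02 := v 0 2 isT isT.
pose x10 := v 1 0 isT isT; pose x11 := v 1 1 isT isT; pose x12 := v 1 2 isT isT.
pose x20 := v 2 0 isT isT; pose x21 := v 2 1 isT isT; pose x22 := v 2 2 isT isT.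
(* Colours are read as natural numbers so that the nine values can be generalised and enumerated. *)
have edge x y : adj x y -> nat_of_ord (c x) != c y by apply: c_proper.
have path5 a b d e z : path (@adj _) a [:: b; d; e; z] ->
    uniq [:: a; b; d; e; z] ->
    ~~ [&& c a == c d :> nat, c d == c z :> nat & c b == c e :> nat].
  exact: c_path.
move: (edge x11 x01 isT) (edge x11 x10 isT) (edge x11 x12 isT) (edge x11 x21 isT).
move: (edge x00 x01 isT) (edge x00 x10 isT) (edge x02 x01 isT) (edge x02 x12 isT).
move: (edge x20 x21 isT) (edge x20 x10 isT) (edge x22 x21 isT) (edge x22 x12 isT).
(* These seven paths suffice: every proper 3-colouring makes one of them bicolored. *)
move: (path5 x20 x21 x11 x12 x02 isT isT) (path5 x00 x01 x11 x12 x22 isT isT).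
move: (path5 x01 x00 x10 x20 x21 isT isT) (path5 x20 x10 x11 x12 x22 isT isT).
move: (path5 x01 x02 x12 x22 x21 isT isT) (path5 x00 x10 x11 x12 x02 isT isT).
move: (path5 x02 x01 x11 x21 x22 isT isT).
have c_lt x : c x < 3 by apply: ltn_ord.
move: (c_lt x11) (c_lt x01) (c_lt x10) (c_lt x12) (c_lt x21).
move: (c_lt x00) (c_lt x02) (c_lt x20) (c_lt x22).
move: (nat_of_ord (c x22)) (nat_of_ord (c x20)) (nat_of_ord (c x02)).
move: (nat_of_ord (c x00)) (nat_of_ord (c x21)) (nat_of_ord (c x12)).
move: (nat_of_ord (c x10)) (nat_of_ord (c x01)) (nat_of_ord (c x11)).
by do 9!case=> [|[|[|?]]] //.
Qed.

Theorem corollary11 (i j : nat) (hi : 3 <= i) (hj : 3 <= j)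
    (hi5 : i <> 5) (hj5 : j <> 5) :
  Pk_chromatic_number (path_graph i □ cycle_graph j) 5 = 4.
Proof.
have [col_min min_col] := @Pk_chromatic_numberP (path_graph i □ cycle_graph j) 5 isT.
apply/eqP; rewrite eqn_leq; apply/andP; split.
  have := Pk_coloring_colorable (dist2_cart_P5 (dist2_path i) (dist2_cycle hj hj5)).
  by rewrite card_prod card_bool => /min_col.
rewrite ltnNge; apply: contra P3_cart_P3_not_3colorable => le3.
pose h (u : path_graph 3 □ path_graph 3) : path_graph i □ cycle_graph j :=
  (widen_ord hi u.1, widen_ord hj u.2).
apply: (@Pk_colorable_sub _ _ h) (Pk_colorable_leq le3 col_min).
  by case=> [a b] [a' b'] [] /val_inj-> /val_inj->.
case=> [a b] [a' b'] /orP[]/andP[/= /eqP<- ab]; apply/orP; [left|right]; rewrite /= eqxx //=.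
(* Both indices are below [3 <= j], so the successor modulo [j] does not wrap around along this
   edge. *)
have b_lt : b < 3 by []. have b'_lt : b' < 3 by [].
case/orP: ab => /eqP ab; rewrite /cycle_adj /= -val_eqE /=; apply/andP; split; try lia.
  by apply/orP; left; rewrite modn_small; lia.
by apply/orP; right; rewrite modn_small; lia.
Qed.
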